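(* Let $X$ be a pseudocompact Tychonoff space, let $\beta X$ be its Stone–Čech compactification and let $\beta: X\to\beta X$ be the canonical embedding. Then the following assertions are equivalent: (i) $X$ is selectively $\omega$-bounded; (ii) the adjoint map $\beta^\ast: C(\beta X)\to C_k(X)$, $\beta^\ast(f)=f\circ\beta$, is compact-covering; (iii) $X$ is an Ascoli space; (iv) $X$ is a sequentially Ascoli space.
   Context: All topological spaces are assumed to be Tychonoff (completely regular Hausdorff). For a space $X$, $C(X)$ is the set of all continuous real-valued functions on $X$, and $C_k(X)$ denotes $C(X)$ endowed with the compact-open topology. $C(\beta X)$ carries its Banach space (sup-norm) topology, which is the compact-open topology since $\beta X$ is compact. A space $X$ is pseudocompact if every continuous real-valued function on $X$ is bounded. A space $X$ is selectively $\omega$-bounded if for any sequence $\{U_n\}_{n\in\omega}$ of nonempty open subsets of $X$ there exists a sequence $(x_n)_{n\in\omega}\in\prod_{n\in\omega}U_n$ containing a subsequence $(x_{n_k})_{k\in\omega}$ with compact closure (i.e. the closure in $X$ of the set $\{x_{n_k}:k\in\omega\}$ is compact). A continuous map $f:X\to Y$ between topological spaces is compact-covering if for every compact subset $K$ of $Y$ there is a compact subset $C$ of $X$ such that $f(C)=K$. A subset $K\subseteq C(X)$ is equicontinuous if for every $x_0\in X$ and every $\varepsilon>0$ there is an open neighborhood $U$ of $x_0$ such that $|f(x)-f(x_0)|<\varepsilon$ for all $x\in U$ and $f\in K$. A space $X$ is Ascoli if every compact subset of $C_k(X)$ is equicontinuous. A space $X$ is sequentially Ascoli if every convergent sequence in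 $C_k(X)$ is equicontinuous (a convergent sequence being regarded as the set of its terms together with its limit). *)

(* Defs.v *)
From HB Require Import structures.
From mathcomp Require Import all_boot all_order all_algebra.
From mathcomp Require Import all_classical all_reals all_analysis.

Set Implicit Arguments.
Unset Strict Implicit.
Unset Printing Implicit Defensive.

Import Order.TTheory GRing.Theory Num.Theory.
Import numFieldNormedType.Exports.

Local Open Scope classical_set_scope.
Local Open Scope ring_scope.

Definition tychonoff_space (X : topologicalType) : Prop :=
  hausdorff_space X /\ completely_regular_space X.

Lemma tychonoff_spaceP (R : realType) (X : topologicalType) :
  tychonoff_space X <->
  hausdorff_space X /\
  forall (x : X) (B : set X), closed B -> ~ B x ->
    exists f : X -> R, [/\ continuous f, range f `<=` `[0, 1],
      f x = 0 & f @` B `<=` [set 1]].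
Proof.
split=> -[hX crX]; split=> // x B cB nBx.
  have /(uniform_separatorP (R := R))[f [cf f01 f0 f1]] := crX _ _ cB nBx.
  by exists f; split=> //; apply: f0; exists x.
have [f [cf f01 f0 f1]] := crX _ _ cB nBx.
by apply/(uniform_separatorP (R := R)); exists f; split=> // _ [_ -> <-].
Qed.

Definition pseudocompact (R : realType) (X : topologicalType) : Prop :=
  forall f : X -> R, continuous f -> bounded_fun f.

Definition selectively_omega_bounded (X : topologicalType) : Prop :=
  forall U : nat -> set X,
    (forall n, open (U n)) -> (forall n, U n !=set0) ->
    exists2 x : nat -> X, (forall n, U n (x n)) &
    exists2 s : nat -> nat, {homo s : m n / (m < n)%N} &
      compact (closure (range (x \o s))).

Lemma set_type_compact (X : topologicalType) (A : set X) :
  compact A -> compact [set: A].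
Proof.
move=> cA F FF _.
have [p [Ap clp]] : A `&` cluster (fmap (set_val : A -> X) F) !=set0.
  apply: cA.
  apply: (@filterS _ F FF setT); last exact: filterT.
  by move=> [x Ax] _; exact: set_mem Ax.
exists (exist _ p (mem_set Ap)); split=> // P Q FP [_ [[B oB <-] Bp] BQ].
have [_ [[a Pa <-] Ba]] : set_val @` P `&` B !=set0.
  apply: clp; last exact: open_nbhs_nbhs.
  by apply: (@filterS _ F FF P) => // a Pa; exists a.
by exists a; split=> //; exact: BQ.
Qed.

Lemma set_type_hausdorff (X : topologicalType) (A : set X) :
  hausdorff_space X -> hausdorff_space A.
Proof.
move=> hX p q clpq; apply: val_inj; apply: hX => P Q nP nQ.
have [a [Pa Qa]] := clpq (set_val @^-1` P) (set_val @^-1` Q)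
  (@initial_continuous _ _ set_val p P nP)
  (@initial_continuous _ _ set_val q Q nQ).
by exists (set_val a).
Qed.

Definition compact_covering (X Y : topologicalType) (f : X -> Y) : Prop :=
  continuous f /\
  forall K : set Y, compact K -> exists2 C : set X, compact C & f @` C = K.

Definition Ck (X Y : topologicalType) : Type := continuousType X Y.

HB.instance Definition _ (X Y : topologicalType) :=
  Topological.copy (Ck X Y)
    (initial_topology (id : continuousType X Y -> {compact-open, X -> Y})).

(* Uniform convergence on X: for compact X and Y = R, the topology of the
   sup norm. *)
Definition Cu (X : topologicalType) (Y : uniformType) : Type :=
  continuousType X Y.

HB.instance Definition _ (X : topologicalType) (Y : uniformType) :=
  Uniform.copy (Cu X Y)
    (initial_topology (id : continuousType X Y -> {uniform X -> Y})).

Definition ascoli_space (R : realType) (X : topologicalType) : Prop :=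
  forall K : set (Ck X R), compact K ->
    equicontinuous K (fun f : Ck X R => (f : continuousType X R) : X -> R).

Definition sequentially_ascoli_space (R : realType) (X : topologicalType) :
    Prop :=
  forall (u : nat -> Ck X R) (l : Ck X R), u @ \oo --> l ->
    equicontinuous (range u `|` [set l])
      (fun f : Ck X R => (f : continuousType X R) : X -> R).

Section stone_cech.
Variables (R : realType) (X : topologicalType).

Let I : topologicalType := `[0%R, 1%R]%classic : set R.

(* The Stone-Cech compactification is the closure of the image of X under
   evaluation in the cube [0, 1]^C(X, [0, 1]). *)
Definition sc_cube : Type := {ptws continuousType X I -> I}.
HB.instance Definition _ := Topological.on sc_cube.

Definition sc_eval (x : X) : sc_cube := fun f => f x.

Definition stone_cech : Type := closure (range sc_eval).
HB.instance Definition _ :=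
  Topological.copy stone_cech (set_type (closure (range sc_eval))).

Definition sc_embed (x : X) : stone_cech :=
  exist _ (sc_eval x) (mem_set (subset_closure (imageT sc_eval x))).

Lemma sc_eval_continuous : continuous sc_eval.
Proof.
move=> x; apply/cvg_sup => f U [_ [[B oB <-] Bfx]] /filterS; apply.
by apply: (@cts_fun _ _ f x); exact: open_nbhs_nbhs.
Qed.

Lemma sc_embed_continuous : continuous sc_embed.
Proof.
apply/continuousP => _ [B oB <-].
by apply: open_comp oB => x _; exact: sc_eval_continuous.
Qed.

HB.instance Definition _ := isContinuous.Build X stone_cech sc_embed
  sc_embed_continuous.

Definition sc_adjoint (f : Cu stone_cech R) : Ck X R :=
  (f : continuousType stone_cech R) \o sc_embed.

Lemma sc_cube_compact : compact [set: sc_cube].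
Proof.
have cI : compact [set: I] by apply/set_type_compact/segment_compact.
have := @tychonoff (continuousType X I) (fun=> I) (fun=> setT) (fun=> cI).
by congr compact; apply/seteqP; split.
Qed.

Lemma stone_cech_compact : compact [set: stone_cech].
Proof.
apply: set_type_compact; apply: subclosed_compact sc_cube_compact _ => //.
exact: closed_closure.
Qed.

Lemma stone_cech_hausdorff : hausdorff_space stone_cech.
Proof.
apply: set_type_hausdorff.
have hI : hausdorff_space I by apply/set_type_hausdorff/Rhausdorff.
exact: (@hausdorff_product (continuousType X I) (fun=> I) (fun=> hI)).
Qed.

Lemma sc_embed_dense : dense (range sc_embed).
Proof.
move=> O [p Op] [B oB BO]; move: Op; rewrite -BO => Bp.
have clp : closure (range sc_eval) (set_val p) by exact: set_valP.
have [_ [[x _ <-] Bx]] := clp B (open_nbhs_nbhs (conj oB Bp)).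
by exists (sc_embed x); split=> //; exists x.
Qed.

Lemma sc_embed_extension (f : X -> I) : continuous f ->
  exists2 g : stone_cech -> I, continuous g & g \o sc_embed = f.
Proof.
move=> cf; pose f' : continuousType X I := mkcts cf.
exists (fun p : stone_cech => (set_val p : sc_cube) f') => //.
apply/continuousP => B oB.
exists (proj f' @^-1` B) => //.
by apply: open_comp oB => p _; exact: (@proj_continuous _ (fun=> I)).
Qed.

Lemma sc_embed_embedding : tychonoff_space X ->
  injective sc_embed /\
  forall A : set X, open A -> exists2 B, open B & sc_embed @^-1` B = A.
Proof.
move=> /(tychonoff_spaceP R)[hX crX].
have sep (x : X) (A : set X) : open A -> A x ->
    exists2 B, open B & B (sc_embed x) /\ sc_embed @^-1` B `<=` A.
  move=> oA Ax.
  have [|f [cf f01 fx f1]] := crX x (~` A) (open_closedC oA); first exact.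
  pose g (y : X) : I := exist _ (f y) (mem_set (f01 _ (imageT f y))).
  have cg : continuous g.
    by apply/continuousP => _ [B oB <-]; apply: open_comp oB => y _; exact: cf.
  have [h ch hg] := sc_embed_extension cg.
  exists (h @^-1` (set_val @^-1` [set r : R | r < 1])).
    apply: open_comp => [y _|]; first exact: ch.
    by exists [set r : R | r < 1] => //; exact: open_lt.
  have hE y : set_val (h (sc_embed y)) = f y.
    by rewrite -[h _]/((h \o _) y) hg.
  split=> [|y]; rewrite /= hE ?fx ?ltr01//; apply: contraPP => nAy.
  by rewrite (f1 (f y)) ?ltxx//; exists y.
split=> [x y xy|A oA].
  apply: hX => P Q; rewrite nbhsE => -[A [oA Ax] AP] /nbhs_singleton Qy.
  have [B _ [Bx BA]] := sep x A oA Ax.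
  by exists y; split=> //; apply/AP/BA; rewrite /= -xy.
exists (\bigcup_(B in [set B | open B /\ sc_embed @^-1` B `<=` A]) B).
  by apply: bigcup_open => B [].
apply/seteqP; split=> [x [B [_ BA]]|x Ax]; first exact: BA.
by have [B oB [Bx BA]] := sep x A oA Ax; exists B.
Qed.

End stone_cech.

(* Main.v *)
Require Import Defs.
From mathcomp Require Import all_boot all_order all_algebra.
From mathcomp Require Import all_classical all_reals all_analysis.
From mathcomp Require Import lra.

(** The four properties are proved equivalent in a cycle.

    From (i) to (ii): the first step is that a sequence converging in [Ck X R]
    converges uniformly, since otherwise the open sets where its terms stay far
    from the limit would meet a compact set infinitely often. The second step is
    that a compact [K] in [Ck X R] is sequentially compact. A cluster point [h]
    of a sequence [f n] in [K] takes equal values at points that no [f n]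
    separates, and selective omega-boundedness upgrades this: [h] is determined
    by its values on a countable set dense for the topology induced by the [f n]
    ([eq_of_eq_on_dense]). A subsequence tending to [h] pointwise on that set then
    has no other cluster point in [K], so it converges to [h]. Together the two
    steps make [K] totally bounded for uniform convergence. Since [X] is
    pseudocompact and dense in its compactification, the adjoint map is a
    bijection preserving uniform distances; the preimage of [K] is totally
    bounded, and each ultrafilter on it converges, uniformly, to the function
    provided by the compactness of [K].

    From (ii) to (iii): a set of functions that is compact for uniform convergence
    is equicontinuous, and [K] is the restriction to [X] of such a set.

    From (iii) to (iv): a convergent sequence together with its limit is compact.

    From (iv) to (i): if (i) fails for open sets [U n], every compact set meets
    only finitely many of them. Bump functions supported in the [U n] then tend to
    [0] in [Ck X R], so they are equicontinuous, and multiples of their truncations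
    have a locally finite sum, which is an unbounded continuous function. *)

Set Implicit Arguments.
Unset Strict Implicit.
Unset Printing Implicit Defensive.

Import Order.TTheory GRing.Theory Num.Theory.
Import numFieldNormedType.Exports.

Local Open Scope classical_set_scope.
Local Open Scope ring_scope.

(** * Sequences, compactness and ultrafilters *)

(** [P k n] may depend on the rank [k] of the extracted term: this is what lets
    a subsequence approximate its limit at precision [1 / k]. *)
Lemma subseq_of_frequently (P : nat -> nat -> Prop) :
  (forall k N, exists2 n, (N <= n)%N & P k n) ->
  exists2 s : nat -> nat, {homo s : m n / (m < n)%N} & forall k, P k (s k).
Proof.
move=> H.
have /choice[f fP] (kN : nat * nat) : exists n, (kN.2 <= n)%N /\ P kN.1 n.
  by have [n] := H kN.1 kN.2; exists n.
pose s := fix s k := if k is k'.+1 then f (k, (s k').+1) else f (0, 0)%N.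
have sP k : P k (s k).
  by case: k => [|k]; [case: (fP (0, 0)%N)|case: (fP (k.+1, (s k).+1))].
exists s => //; apply: homo_ltn => [|k]; first exact: ltn_trans.
by have [] := fP (k.+1, (s k).+1).
Qed.

Lemma leq_homo_ltn (s : nat -> nat) :
  {homo s : m n / (m < n)%N} -> forall n, (n <= s n)%N.
Proof. by move=> sh; elim=> // n /leq_ltn_trans; apply; exact: sh. Qed.

Lemma compact_sequence_limit (T : topologicalType) (u : nat -> T) (l : T) :
  u @ \oo --> l -> compact (range u `|` [set l]).
Proof.
move=> ul; apply/compact_near_coveringP => I F P FF H.
have [[A B] /= [lA FB] AB] := H l (or_intror erefl).
have [N _ NA] := ul _ lA.
have Fn (m : 'I_N) : \forall i \near F, P i (u m).
  have [[A' B'] /= [lA' FB'] AB'] := H (u m) (or_introl (imageT u m)).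
  apply: filterS FB' => i B'i; apply: (AB' (u m, i)); split=> //.
  exact: nbhs_singleton.
have {}Fn : \forall i \near F, forall m : 'I_N, P i (u m).
  exact: filter_forall.
apply: filterS2 Fn FB => i Pn Bi x [[n _ <-]|->]; last first.
  by apply: (AB (l, i)); split=> //; exact: nbhs_singleton.
have [nN|Nn] := ltnP n N; first exact: (Pn (Ordinal nN)).
by apply: (AB (u n, i)); split=> //; exact: NA.
Qed.

(** If the terms of [u] that miss a neighbourhood of [l] recurred, they would
    have a second cluster point in [K]. The covering argument below finds a common
    rank for all points [h] of [K], after which it is used at [h = u n]. *)
Lemma compact_cvg_unique_cluster (T : topologicalType) (K : set T)
    (u : nat -> T) (l : T) : compact K -> (forall n, K (u n)) ->
  (forall h, K h -> cluster (u @ \oo) h -> h = l) -> u @ \oo --> l.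
Proof.
move=> /compact_near_coveringP cK Ku ul A lA.
have : \forall n \near \oo, K `<=` (fun h => u n = h -> A h).
  apply: cK => h Kh.
  have [clh|] := pselect (cluster (u @ \oo) h).
    exists (A, setT); last by move=> [y n] [].
    by split=> /=; [rewrite (ul h Kh clh)|exact: filterT].
  move=> /existsNP[B /existsNP[C /not_implyP[uB /not_implyP[hC nBC]]]].
  exists (C, u @^-1` B); first by [].
  by move=> [y n] /= [Cy Bn] uny; case: nBC; exists y; split=> //; rewrite -uny.
by apply: filterS => n; apply.
Qed.

(** An ultrafilter is prime, hence contains one member of any finite cover. *)
Lemma ultra_bigcup_seq (T : Type) (I : eqType) (F : set_system T)
    (A : I -> set T) (s : seq I) : UltraFilter F ->
  F [set t | exists2 i, i \in s & A i t] -> exists2 i, i \in s & F (A i).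
Proof.
move=> FU; elim: s => [|i s IHs] Fs.
  by have [t []] := @filter_ex _ F _ _ Fs.
have [FA|FnA] := in_ultra_setVsetC (A i) FU.
  by exists i => //; exact: mem_head.
have [|j js FAj] := IHs; last by exists j => //; rewrite inE js orbT.
apply: filterS2 Fs FnA => t [j]; rewrite inE => /orP[/eqP ->//|js Aj _].
by exists j.
Qed.

(** Dependent choice along the finite sequence of the terms already chosen. *)
Lemma separated_sequence (T : eqType) (K : set T) (r : T -> T -> Prop) :
  (forall s : seq T, {in s, forall g, K g} ->
    exists2 f, K f & {in s, forall g, r f g}) ->
  exists2 u : nat -> T, (forall n, K (u n)) &
    forall m n, (m < n)%N -> r (u n) (u m).
Proof.
move=> H.
have /choice[F FP] (s : seq T) : exists f, {in s, forall g, K g} ->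
    K f /\ {in s, forall g, r f g}.
  have [/H[f Kf rf]|nK] := pselect {in s, forall g, K g}; first by exists f.
  by have [f _ _] := H [::] (fun _ => ltac:(by [])); exists f => /nK.
(* [st n] lists the first [n] terms. *)
pose st n := iter n (fun s => F s :: s) [::].
have Kst n : {in st n, forall g, K g}.
  elim: n => [//|n IHn] g /=; rewrite inE => /orP[/eqP ->|/IHn//].
  by have [] := FP _ IHn.
exists (F \o st) => [n|m n mn]; first by have [] := FP _ (Kst n).
have [_] := FP _ (Kst n); apply.
elim: n mn => // n IHn; rewrite ltnS leq_eqVlt => /orP[/eqP ->|/IHn mn].
  exact: mem_head.
by rewrite /= inE mn orbT.
Qed.

(** * Real functions *)

Lemma eq_of_dist (R : realType) (a b : R) :
  (forall e, 0 < e -> `|a - b| < e) -> a = b.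
Proof.
move=> H; apply/eqP; rewrite -subr_eq0 -normr_eq0 eq_le normr_ge0 andbT leNgt.
by apply/negP => /H; rewrite ltxx.
Qed.

Lemma continuous_dist (R : realType) (T : topologicalType) (f g : T -> R) :
  continuous f -> continuous g -> continuous (fun x => `|f x - g x|).
Proof.
by move=> cf cg x; apply: cvg_norm; apply: cvgB; [exact: cf|exact: cg].
Qed.

Lemma open_dist_gt (R : realType) (T : topologicalType) (f g : T -> R) (e : R) :
  continuous f -> continuous g -> open [set x | e < `|f x - g x|].
Proof.
move=> cf cg; apply: (@open_comp _ _ _ [set r | e < r]); last exact: open_gt.
by move=> x _; exact: continuous_dist.
Qed.

Lemma open_dist_lt (R : realType) (T : topologicalType) (f g : T -> R) (e : R) :
  continuous f -> continuous g -> open [set x | `|f x - g x| < e].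
Proof.
move=> cf cg; apply: (@open_comp _ _ _ [set r | r < e]); last exact: open_lt.
by move=> x _; exact: continuous_dist.
Qed.

(** The topology induced by countably many real functions is second countable.
    For each precision [1 / (p + 1)] and each finite list [q] of rationals, choose
    a point whose values under [f] are that close to [q], if there is one; the
    pairs [(p, q)] are countably many. *)
Lemma countable_dense_induced (R : realType) (X : Type) (x0 : X)
    (f : nat -> X -> R) :
  exists d : nat -> X, forall x j (e : R), 0 < e ->
    exists k, forall i, (i < j)%N -> `|f i x - f i (d k)| < e.
Proof.
(* A code [c] is a precision together with a list of target values. *)
pose near (c : nat * seq rat) x := forall i, (i < size c.2)%N ->
  `|f i x - ratr (nth 0 c.2 i)| < c.1.+1%:R^-1.
have /choice[D DP] c : exists y, (exists x, near c x) -> near c y.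
  have [[y cy]|nc] := pselect (exists x, near c x); first by exists y.
  by exists x0.
exists (fun k => if unpickle k is Some c then D c else x0) => x j e e0.
have e2 : 0 < e / 2 by rewrite divr_gt0.
have [p _ /(_ p (leqnn p))/= pe] := near_infty_natSinv_lt (PosNum e2).
have p0 : 0 < p.+1%:R^-1 :> R by rewrite invr_gt0 ltr0n.
have /choice[q qP] i : exists q : rat, `|f i x - ratr q| < p.+1%:R^-1.
  have /rat_in_itvoo[q] : f i x - p.+1%:R^-1 < f i x + p.+1%:R^-1.
    by rewrite ltrBlDr -addrA ltrDl addr_gt0.
  by rewrite in_itv/= -ltr_distlC => fq; exists q.
pose c : nat * seq rat := (p, mkseq q j).
have cx : near c x by move=> i; rewrite size_mkseq => ij; rewrite nth_mkseq.
exists (pickle c) => i ij; rewrite pickleK.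
have ij' : (i < size c.2)%N by rewrite size_mkseq.
have {}pe t : t < p.+1%:R^-1 -> t < e / 2 by move=> /lt_trans; apply.
move: (pe _ (cx i ij')) (pe _ (DP c (ex_intro _ x cx) i ij')).
rewrite !ltr_norml => /andP[? ?] /andP[? ?].
by apply/andP; split; lra.
Qed.

(** * Compact-open and uniform convergence *)

(** Elements of [Ck] and [Cu] coerce to functions only through
    [continuousType]. *)
Local Notation fn f := ((f : continuousType _ _) : _ -> _).

(** On continuous functions the compact-open topology is that of uniform
    convergence on compact sets; from here on only this description is used. *)
Lemma Ck_cvgP (R : realType) (X : topologicalType) (F : set_system (Ck X R))
    {FF : Filter F} (f : Ck X R) :
  F --> f <-> forall L : set X, compact L -> forall e : R, 0 < e ->
    \forall g \near F, forall x, L x -> `|fn f x - fn g x| < e.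
Proof.
pose i := (id : continuousType X R -> {compact-open, X -> R}).
have cf : continuous (i f) by exact: cts_fun.
have FiF : Filter (i @ F) by exact: fmap_filter.
(* The topology of [Ck X R] is the initial one for [i]. *)
have -> : (F --> f) <-> {compact-open, i @ F --> i f}.
  split => [Ff|Ff A].
    move=> A /= Af; apply: Ff.
    exact: (@initial_continuous _ _ i f A Af).
  move=> [_ [[B oB <-] Bf] BA]; apply: (filterS BA).
  by apply: Ff; exact: open_nbhs_nbhs.
rewrite (compact_open_fam_compactP cf FiF); split.
  move=> /fam_cvgP H L cL e e0.
  have : nbhs (i f : {uniform` L -> R})
      [set h | forall y, L y -> `|i f y - h y| < e].
    apply/uniform_nbhs; exists [set xy | ball xy.1 e xy.2]; split => //.
    exact: (entourage_ball _ (PosNum e0)).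
  by move=> /(H _ cL).
move=> H; apply/fam_cvgP => L cL A /uniform_nbhs[E [entE EA]].
move: entE; rewrite -entourage_ballE => -[e /= e0 eE].
apply: filterS (H _ cL e e0) => g ge; apply: EA => /= x Lx; apply: eE.
exact: ge.
Qed.

Lemma Cu_nbhsP (R : realType) (X : topologicalType) (f : Cu X R)
    (A : set (Cu X R)) : nbhs f A <-> exists2 e : R, 0 < e &
    forall g : Cu X R, (forall x, `|fn f x - fn g x| < e) -> A g.
Proof.
pose i := (id : continuousType X R -> {uniform X -> R}).
split => [[_ [[B oB <-] Bf] BA]|[e e0 eA]].
  have /uniform_nbhs[E [entE EB]] : nbhs (i f) B by exact: open_nbhs_nbhs.
  move: entE; rewrite -entourage_ballE => -[e /= e0 eE].
  by exists e => // g ge; apply/BA/EB => x _; apply: eE; exact: ge.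
have : nbhs (i f) [set h | forall y, setT y -> `|i f y - h y| < e].
  apply/uniform_nbhs; exists [set xy | ball xy.1 e xy.2]; split => //=.
  exact: (entourage_ball _ (PosNum e0)).
move=> /(@initial_continuous _ _ i f) Hn.
apply: (@filterS _ (nbhs f) _ _ _ _ Hn) => g ge; apply: eA => x; exact: ge.
Qed.

Lemma Ck_clusterP (R : realType) (X : topologicalType) (u : nat -> Ck X R)
    (h : Ck X R) : cluster (u @ \oo) h ->
  forall L : set X, compact L -> forall e : R, 0 < e ->
  forall N, exists2 n, (N <= n)%N & forall x, L x -> `|fn h x - fn (u n) x| < e.
Proof.
move=> uh L cL e e0 N.
have hL : nbhs h [set g : Ck X R | forall x, L x -> `|fn h x - fn g x| < e].
  by have /Ck_cvgP/(_ L cL e e0) : nbhs h --> h by [].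
have uN : (u @ \oo) (u @` [set n | (N <= n)%N]).
  by exists N => // n Nn; exists n.
by have [_ [[n Nn <-] nL]] := uh _ _ uN hL; exists n.
Qed.

(** A cluster point is a function of the sequence [u]: it is constant on the
    fibers of the map [x |-> (u n x)_n]. Together with selective
    omega-boundedness this does the work of continuity for the topology induced
    by that map. *)
Lemma cluster_eq_fibers (R : realType) (X : topologicalType) (u : nat -> Ck X R)
    (h : Ck X R) (x y : X) : cluster (u @ \oo) h ->
  (forall n, fn (u n) x = fn (u n) y) -> fn h x = fn h y.
Proof.
move=> uh uxy; apply: eq_of_dist => e e0.
have cxy : compact [set x; y] by apply: compactU; exact: compact_set1.
have e2 : 0 < e / 2 by rewrite divr_gt0.
have [n _ nxy] := Ck_clusterP uh cxy e2 0%N.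
have := nxy x (or_introl erefl); have := nxy y (or_intror erefl).
rewrite uxy !ltr_norml => /andP[? ?] /andP[? ?].
by apply/andP; split; lra.
Qed.

(** * Selective omega-boundedness *)

(** This form does without the choice of points and of a subsequence: points
    taken in [L] have a compact closure because [L] is closed, and conversely the
    closure of the chosen subsequence serves as [L]. *)
Lemma selectively_omega_boundedP (X : topologicalType) : hausdorff_space X ->
  selectively_omega_bounded X <->
  forall U : nat -> set X, (forall n, open (U n)) -> (forall n, U n !=set0) ->
    exists2 L, compact L & forall N, exists2 n, (N <= n)%N & U n `&` L !=set0.
Proof.
move=> hX; split=> sX U oU U0.
  have [x Ux [s sh cL]] := sX U oU U0.
  exists (closure (range (x \o s))) => // N.
  exists (s N); first exact: leq_homo_ltn.
  by exists (x (s N)); split; [exact: Ux|apply: subset_closure; exists N].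
have [L cL LU] := sX U oU U0.
have [s sh sL] := subseq_of_frequently (fun=> LU).
have /choice[x xP] n : exists y, U n y /\ (U n `&` L !=set0 -> L y).
  have [[y [Uy Ly]]|nL] := pselect (U n `&` L !=set0); first by exists y.
  by have [y Uy] := U0 n; exists y.
exists x => [n|]; first by have [] := xP n.
exists s => //; apply: (subclosed_compact _ cL); first exact: closed_closure.
have /closure_id -> : closed L by exact: compact_closed.
apply: closureS => _ [k _ <-].
by have [_] := xP (s k); apply; exact: sL.
Qed.

Lemma selectively_omega_bounded_accumulation (X : topologicalType) :
  selectively_omega_bounded X ->
  forall U : nat -> set X, (forall n, open (U n)) -> (forall n, U n !=set0) ->
  exists y : X, forall A, nbhs y A ->
    forall N, exists2 n, (N <= n)%N & U n `&` A !=set0.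
Proof.
move=> sX U oU U0; have [x Ux [s sh cL]] := sX U oU U0.
have [|y [_ cly]] := cL ((x \o s) @ \oo).
  by exists 0%N => // n _; apply: subset_closure; exists n.
exists y => A yA N.
have [||_ [[n Nn <-] An]] := cly ((x \o s) @` [set n | (N <= n)%N]) A => //.
  by exists N => // n Nn; exists n.
exists (s n); first exact: leq_trans Nn (leq_homo_ltn sh n).
by exists (x (s n)); split=> //; exact: Ux.
Qed.

(** Otherwise the open sets where [u (s N)] is [e]-far from [l] are nonempty for
    some indices [s N >= N], and points taken in them accumulate in a compact
    set, on which the convergence is uniform. *)
Lemma selectively_omega_bounded_cvg_uniform (R : realType)
    (X : topologicalType) (u : nat -> Ck X R) (l : Ck X R) :
  selectively_omega_bounded X -> u @ \oo --> l ->
  forall e : R, 0 < e ->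
    \forall n \near \oo, forall x, `|fn l x - fn (u n) x| <= e.
Proof.
move=> sX ul e e0; apply: contrapT => nu.
have /choice[s sP] N : exists n,
    (N <= n)%N /\ exists x, e < `|fn l x - fn (u n) x|.
  apply: contrapT => H; apply: nu; exists N => // n Nn x.
  by rewrite leNgt; apply/negP => ex; apply: H; exists n; split=> //; exists x.
pose U N : set X := [set x | e < `|fn l x - fn (u (s N)) x|].
have oU N : open (U N) by apply: open_dist_gt; exact: cts_fun.
have U0 N : U N !=set0 by have [_] := sP N.
have [x Ux [t th cL]] := sX U oU U0.
have [N _ NL] := (Ck_cvgP _).1 ul _ cL e e0.
have := Ux (t N); rewrite /U/= ltNge => /negP; apply; apply: ltW.
apply: NL => /=.
  by apply: leq_trans (leq_homo_ltn th N) _; have [] := sP (t N).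
by apply: subset_closure; exists N.
Qed.

(** Fix [x]. The open set [U j] asks that [f 0], ..., [f (j - 1)] be
    [1 / (j + 1)]-close to their values at [x], and [h] be as close to [h']. It
    contains a point of the dense set that approximates [x]. At an accumulation
    point [y] of these sets, every [f n] takes its value at [x] and [h y = h' y];
    hence [h x = h y = h' y = h' x]. *)
Lemma eq_of_eq_on_dense (R : realType) (X : topologicalType)
    (f : nat -> X -> R) (h h' : X -> R) (d : nat -> X) :
  selectively_omega_bounded X ->
  (forall n, continuous (f n)) -> continuous h -> continuous h' ->
  (forall x y, (forall n, f n x = f n y) -> h x = h y) ->
  (forall x y, (forall n, f n x = f n y) -> h' x = h' y) ->
  (forall x j (e : R), 0 < e -> exists k, forall i, (i < j)%N ->
    `|f i x - f i (d k)| < e) ->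
  (forall k, h (d k) = h' (d k)) -> h =1 h'.
Proof.
move=> sX cf ch ch' hE h'E fd hd x.
pose V (j : nat) : set X :=
  [set y | forall i : 'I_j, `|f i x - f i y| < j.+1%:R^-1].
pose U j : set X := V j `&` [set y | `|h y - h' y| < j.+1%:R^-1].
have oUj j : open (U j).
  apply: openI; last exact: open_dist_lt.
  rewrite openE => y Vy; apply: filter_forall => i.
  by apply: open_nbhs_nbhs; split;
    [apply: (@open_dist_lt _ _ (fun=> f i x)) => // z; exact: cvg_cst|
     exact: Vy].
have inv0 j : 0 < j.+1%:R^-1 :> R by rewrite invr_gt0 ltr0n.
have U0 j : U j !=set0.
  have [k kP] := fd x j _ (inv0 j).
  by exists (d k); split; [move=> i; exact: kP|rewrite /= hd subrr normr0].
have [y yP] := selectively_omega_bounded_accumulation sX oUj U0.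
have eqy (a b : X -> R) (i : nat) : continuous a -> continuous b ->
    (forall j, (i <= j)%N -> forall z, U j z -> `|a z - b z| < j.+1%:R^-1) ->
    a y = b y.
  move=> ca cb abU; apply: eq_of_dist => e e0.
  have e3 : 0 < e / 3 by rewrite divr_gt0.
  have [N _ NP] := near_infty_natSinv_lt (PosNum e3).
  have yab : nbhs y [set z | `|a y - a z| < e / 3 /\ `|b y - b z| < e / 3].
    by apply: filterI; [move/cvgrPdist_lt : (ca y)|move/cvgrPdist_lt : (cb y)];
      apply.
  have [n] := yP _ yab (maxn i N).
  rewrite geq_max => /andP[/abU nab /NP/= n3] [z [/nab abz [az bz]]].
  move: (lt_trans abz n3) az bz.
  rewrite !ltr_norml => /andP[? ?] /andP[? ?] /andP[? ?].
  by apply/andP; split; lra.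
have fxy i : f i x = f i y.
  apply: (eqy (fun=> f i x) (f i) i.+1) => [z|//|j ij z [Vz _]].
    exact: cvg_cst.
  exact: (Vz (Ordinal ij)).
rewrite (hE _ _ fxy) (h'E _ _ fxy).
by apply: (eqy h h' 0%N) => // j _ z [].
Qed.

(** Let [f] be a cluster point of [u]. A subsequence of [u] converges to [f] on a
    countable set that is dense for the topology induced by [u]. Any cluster
    point of the subsequence agrees with [f] on that set, hence everywhere by
    [eq_of_eq_on_dense]; so the subsequence converges to [f]. *)
Lemma selectively_omega_bounded_seq_compact (R : realType)
    (X : topologicalType) (K : set (Ck X R)) (u : nat -> Ck X R) :
  selectively_omega_bounded X -> X -> compact K -> (forall n, K (u n)) ->
  exists2 s : nat -> nat, {homo s : m n / (m < n)%N} &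
    exists l : Ck X R, (u \o s) @ \oo --> l.
Proof.
move=> sX x0 cK Ku.
have [|f [Kf uf]] := cK (u @ \oo); first by exists 0%N => // n _; exact: Ku.
have [d dP] := countable_dense_induced x0 (fun n => fn (u n)).
have inv0 j : 0 < j.+1%:R^-1 :> R by rewrite invr_gt0 ltr0n.
pose P k n := forall i, (i <= k)%N ->
  `|fn f (d i) - fn (u n) (d i)| < k.+1%:R^-1.
have [k N|s sh sP] := @subseq_of_frequently P.
  have cL : compact (d @` `I_k.+1).
    by apply: finite_compact; apply: finite_image; exact: finite_II.
  have [n Nn nP] := Ck_clusterP uf cL (inv0 k) N.
  by exists n => // i ik; apply: nP; exists i.
exists s => //; exists f.
apply: (compact_cvg_unique_cluster cK) => [n|h Kh ush]; first exact: Ku.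
have uh : cluster (u @ \oo) h.
  move=> A B [N _ NA] hB; apply: ush => //.
  by exists N => // n Nn; apply: NA; exact: leq_trans Nn (leq_homo_ltn sh n).
apply/continuousEP.
apply: (@eq_of_eq_on_dense R X (fun n => fn (u n)) _ _ d) => //.
- by move=> n; exact: cts_fun.
- exact: cts_fun.
- exact: cts_fun.
- by move=> x y; exact: cluster_eq_fibers.
- by move=> x y; exact: cluster_eq_fibers.
move=> k; apply: eq_of_dist => e e0.
have e2 : 0 < e / 2 by rewrite divr_gt0.
have [N _ NP] := near_infty_natSinv_lt (PosNum e2).
have [n] := Ck_clusterP ush (@compact_set1 _ (d k)) e2 (maxn k N).
rewrite geq_max => /andP[/(sP n) nk /NP/= n2] /(_ _ erefl) /=.
move: (lt_trans nk n2).
rewrite !ltr_norml => /andP[? ?] /andP[? ?].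
by apply/andP; split; lra.
Qed.

(** A sequence in [K] whose terms are pairwise [e]-apart would have a convergent
    subsequence, and that convergence would be uniform. *)
Lemma selectively_omega_bounded_totally_bounded (R : realType)
    (X : topologicalType) (K : set (Ck X R)) (e : R) :
  selectively_omega_bounded X -> compact K -> 0 < e ->
  exists2 s : seq (Ck X R), {in s, forall g, K g} &
    forall f, K f -> exists2 g, g \in s & forall x, `|fn f x - fn g x| < e.
Proof.
move=> sX cK e0; apply: contrapT => nK.
have [s Ks|u Ku ru] := @separated_sequence _ K
    (fun f g : Ck X R => exists x, e <= `|fn f x - fn g x|).
  apply: contrapT => ns; apply: nK; exists s => // f Kf.
  apply: contrapT => nf; apply: ns; exists f => // g gs.
  apply: contrapT => ng; apply: nf; exists g => // x.
  by rewrite ltNge; apply/negP => fgx; apply: ng; exists x.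
have [x0 _] := ru 0%N 1%N isT.
have [s sh [l ul]] := selectively_omega_bounded_seq_compact sX x0 cK Ku.
have e3 : 0 < e / 3 by rewrite divr_gt0.
have [N _ NP] := selectively_omega_bounded_cvg_uniform sX ul e3.
have [x] := ru _ _ (sh N N.+1 (ltnSn N)).
apply/negP; rewrite -ltNge.
move: (NP N (leqnn N) x) (NP N.+1 (leqnSn N) x).
rewrite /= !ler_norml !ltr_norml => /andP[? ?] /andP[? ?].
by apply/andP; split; lra.
Qed.

(** * The adjoint of the embedding into the Stone-Cech compactification *)

Lemma sc_adjoint_continuous (R : realType) (X : topologicalType) :
  continuous (@sc_adjoint R X).
Proof.
move=> f; have FF := fmap_filter (@sc_adjoint R X) (nbhs_filter f).
apply/Ck_cvgP => L _ e e0.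
by apply/Cu_nbhsP; exists e => // g fg x _; exact: fg.
Qed.

(** Rescale the bounded function [f] into [[0, 1]], extend it, and scale back. *)
Lemma sc_adjoint_surjective (R : realType) (X : topologicalType)
    (f : Ck X R) : pseudocompact R X -> exists phi, sc_adjoint phi = f.
Proof.
move=> pX.
have cf : continuous (fn f) by exact: cts_fun.
have [M0 [_ M0P]] := pX (fn f) cf.
pose M : R := `|M0| + 1.
have M1 : 0 < M by rewrite ltr_wpDl.
have fM x : `|fn f x| <= M.
  by apply: M0P => //; rewrite (le_lt_trans (ler_norm _))// ltrDl.
have g01 x : ((fn f x / M + 1) / 2) \in `[0, 1]%classic.
  apply/mem_set; rewrite /= in_itv/=.
  have : `|fn f x / M| <= 1.
    by rewrite normrM normfV (gtr0_norm M1) ler_pdivrMr// mul1r.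
  by rewrite ler_norml => /andP[? ?]; apply/andP; split; lra.
pose g x : `[0%R, 1%R]%classic := exist _ ((fn f x / M + 1) / 2) (g01 x).
have cg : continuous g.
  apply/continuousP => _ [B oB <-].
  apply: (@open_comp _ _ (fun x => (fn f x / M + 1) / 2)) oB => x _.
  apply: cvgM; last exact: cvg_cst.
  apply: cvgD; last exact: cvg_cst.
  by apply: cvgM; [apply: cf|exact: cvg_cst].
have [h ch hg] := sc_embed_extension cg.
pose phi (p : stone_cech R X) : R := (2 * set_val (h p) - 1) * M.
have cphi : continuous phi.
  have ck : continuous (fun p => set_val (h p) : R).
    move=> p; apply: (@continuous_comp _ _ _ h set_val); first exact: ch.
    exact: (@initial_continuous _ _ set_val).
  have affine (T : topologicalType) (k : T -> R) : continuous k ->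
      continuous (fun q => (2 * k q - 1) * M).
    move=> ck' q; apply: cvgM; last exact: cvg_cst.
    apply: cvgB; last exact: cvg_cst.
    by apply: cvgM; [exact: cvg_cst|exact: ck'].
  exact: affine ck.
exists (mkcts cphi); apply/continuousEP => x.
have -> : fn (sc_adjoint (mkcts cphi)) x = (2 * ((fn f x / M + 1) / 2) - 1) * M.
  rewrite -[LHS]/((2 * set_val ((h \o @sc_embed R X) x) - 1) * M).
  by rewrite hg.
rewrite [2 * _]mulrC divfK ?pnatr_eq0// addrK divfK//; exact: lt0r_neq0.
Qed.

(** The image of [X] is dense, so uniform bounds extend from [X] to the
    compactification: the adjoint map is an isometry for uniform distances. *)
Lemma sc_dist_le (R : realType) (X : topologicalType)
    (phi psi : Cu (stone_cech R X) R) (e : R) :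
  (forall x, `|fn (sc_adjoint phi) x - fn (sc_adjoint psi) x| <= e) ->
  forall p, `|fn phi p - fn psi p| <= e.
Proof.
move=> le_e p; rewrite leNgt; apply/negP => ep.
have oO : open [set q | e < `|fn phi q - fn psi q|].
  by apply: open_dist_gt; exact: cts_fun.
have [q [eq [x _ qE]]] := sc_embed_dense (ex_intro _ p ep) oO.
by move: eq; rewrite /= -qE ltNge => /negP; apply; exact: le_e.
Qed.

(** The full preimage of [K] is compact. The image on [X] of an ultrafilter on
    that preimage clusters at some [h] in [K]. By total boundedness, for each [e]
    the ultrafilter contains a uniform [e / 4]-ball around some [g], and then [h]
    is within [e / 2] of [g]; so the ultrafilter converges uniformly to the
    extension of [h]. *)
Lemma selectively_omega_bounded_compact_covering (R : realType)
    (X : topologicalType) : pseudocompact R X ->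
  selectively_omega_bounded X -> compact_covering (@sc_adjoint R X).
Proof.
move=> pX sX; split; first exact: sc_adjoint_continuous.
move=> K cK; exists (@sc_adjoint R X @^-1` K); last first.
  apply/seteqP; split=> [_ [phi Kphi <-] //|f Kf].
  have [phi phif] := sc_adjoint_surjective f pX.
  by exists phi; rewrite //= phif.
rewrite compact_ultra => F FU FC.
have [//|h [Kh clh]] := cK (@sc_adjoint R X @ F).
have [phi phih] := sc_adjoint_surjective h pX.
exists phi; split; first by rewrite /= phih.
move=> A /Cu_nbhsP[e e0 eA].
have e4 : 0 < e / 4 by rewrite divr_gt0.
have [s Ks sP] := selectively_omega_bounded_totally_bounded sX cK e4.
pose B (g : Ck X R) : set (Cu (stone_cech R X) R) :=
  [set psi | forall x, `|fn (sc_adjoint psi) x - fn g x| < e / 4].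
have [|g gs FB] := @ultra_bigcup_seq _ _ F B s FU.
  by apply: filterS FC => psi /sP.
have hg x : `|fn h x - fn g x| <= e / 2.
  have hx : nbhs h [set k : Ck X R | forall y, [set x] y ->
      `|fn h y - fn k y| < e / 4].
    by have /Ck_cvgP/(_ _ (@compact_set1 _ x) _ e4) : nbhs h --> h by [].
  have FB' : (@sc_adjoint R X @ F)
      [set k : Ck X R | forall x, `|fn k x - fn g x| < e / 4] by exact: FB.
  have [k [/(_ x) kg /(_ x erefl) hk]] := clh _ _ FB' hx.
  move: kg hk; rewrite ler_norml !ltr_norml => /andP[? ?] /andP[? ?].
  by apply/andP; split; lra.
apply: filterS FB => psi psig; apply: eA => p.
apply: (@le_lt_trans _ _ (e * 3 / 4)); last by lra.
apply: sc_dist_le => x; rewrite phih.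
move: (psig x) (hg x); rewrite !ler_norml !ltr_norml => /andP[? ?] /andP[? ?].
by apply/andP; split; lra.
Qed.

(** Evaluation is jointly continuous for the uniform topology, so a uniformly
    compact set [C] is equicontinuous, and so is its restriction to [X]. *)
Lemma compact_covering_ascoli (R : realType) (X : topologicalType) :
  compact_covering (@sc_adjoint R X) -> ascoli_space R X.
Proof.
move=> [_ cov] K /cov[C /compact_near_coveringP cC <-{K}] x E.
rewrite -entourage_ballE => -[e /= e0 eE].
suff : \forall y \near x, C `<=` (fun g =>
    `|fn g (@sc_embed R X x) - fn g (@sc_embed R X y)| < e).
  by apply: filterS => y Cy _ [g /Cy gxy <-]; apply: eE.
apply: cC => f Cf.
have e3 : 0 < e / 3 by rewrite divr_gt0.
have fy : \forall y \near x,
    `|fn f (@sc_embed R X x) - fn f (@sc_embed R X y)| < e / 3.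
  have cx : (fn f \o @sc_embed R X) @ x --> fn f (@sc_embed R X x).
    by apply: continuous_comp; [exact: sc_embed_continuous|exact: cts_fun].
  by move/cvgrPdist_lt : cx; apply.
exists ([set g : Cu (stone_cech R X) R | forall p, `|fn f p - fn g p| < e / 3],
    [set y | `|fn f (@sc_embed R X x) - fn f (@sc_embed R X y)| < e / 3]).
  by split=> //; apply/Cu_nbhsP; exists (e / 3).
move=> [g y] /= [fg fxy].
have := fg (@sc_embed R X x); have := fg (@sc_embed R X y); move: fxy.
rewrite !ltr_norml => /andP[? ?] /andP[? ?] /andP[? ?].
by apply/andP; split; lra.
Qed.

(** * Pseudocompact sequentially Ascoli spaces *)

(** The sum of the [h n] is locally finite, hence continuous, hence bounded, and it
    dominates each [h n] because all terms are nonnegative. *)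
Lemma pseudocompact_bound_locally_vanishing (R : realType)
    (X : topologicalType) (h : nat -> X -> R) : pseudocompact R X ->
  (forall n, continuous (h n)) -> (forall n x, 0 <= h n x) ->
  (forall x : X, \forall n \near \oo & y \near x, h n y = 0) ->
  exists M : R, forall n x, h n x <= M.
Proof.
move=> pX ch h0 hv.
have /choice[N NP] x : exists N, forall n, (N <= n)%N -> h n x = 0.
  have [[A B] /= [[N _ NA] Bx] AB] := hv x; exists N => n /NA An.
  by apply: (AB (n, x)); split=> //; exact: nbhs_singleton.
pose g x := \sum_(n < N x) h n x.
have gE M x : (forall n, (M <= n)%N -> h n x = 0) -> g x = \sum_(n < M) h n x.
  move=> Mx; rewrite /g -!(big_mkord xpredT (fun n => h n x)).
  suff E m m' : (m <= m')%N -> (forall n, (m <= n)%N -> h n x = 0) ->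
      \sum_(0 <= n < m) h n x = \sum_(0 <= n < m') h n x.
    by have [/E|/ltnW/E] := leqP (N x) M => -> //; exact: NP.
  move=> mm' hm; rewrite [RHS](big_cat_nat (leq0n m) mm')//=.
  rewrite [X in _ + X]big1_seq ?addr0//.
  by move=> n; rewrite mem_index_iota => /andP[_ /andP[/hm]].
have cg : continuous g.
  move=> x; have [[A B] /= [[M _ MA] Bx] AB] := hv x.
  have gM : \forall y \near x, \sum_(n < M) h n y = g y.
    apply: filterS Bx => y By; rewrite (gE M)// => n /MA An.
    exact: (AB (n, y)).
  apply: cvg_trans (near_eq_cvg gM) _.
  rewrite (gE M x) => [|n /MA An]; last first.
    by apply: (AB (n, x)); split=> //; exact: nbhs_singleton.
  by apply: (continuous_big add_continuous) => n _; exact: ch.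
have [M [_ MP]] := pX g cg.
exists (M + 1) => n x; apply: (@le_trans _ _ (g x)); last first.
  by apply: le_trans (ler_norm _) _; apply: MP => //; rewrite ltrDl.
rewrite (gE (maxn (N x) n.+1)); last first.
  by move=> m; rewrite geq_max => /andP[/NP].
rewrite (bigD1 (Ordinal (leq_maxr (N x) n.+1)))//= lerDl.
by apply: sumr_ge0.
Qed.

Lemma bump_function (R : realType) (X : topologicalType) (U : set X) :
  tychonoff_space X -> open U -> U !=set0 ->
  exists f : X -> R, [/\ continuous f, exists x, f x = 1 &
    forall x, ~ U x -> f x = 0].
Proof.
move=> /(tychonoff_spaceP R)[_ crX] oU [x Ux].
have [|f [cf _ fx f1]] := crX x (~` U) (open_closedC oU); first exact.
exists (fun y => 1 - f y); split => [y||y nUy].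
- by apply: cvgB; [exact: cvg_cst|exact: cf].
- by exists x; rewrite fx subr0.
- by rewrite (f1 (f y)) ?subrr//; exists y.
Qed.

(** If the open sets [U n] witness the failure of selective omega-boundedness, then
    each compact set meets finitely many of them, so bump functions [f n]
    supported in [U n] tend to [0] in [Ck]. By equicontinuity, near each point
    [f n < 1 / 2] for all large [n]. The functions [n * max (f n - 1 / 2, 0)]
    therefore vanish locally for large [n], yet they take the values
    [n / 2], against pseudocompactness. *)
Lemma sequentially_ascoli_selectively_omega_bounded (R : realType)
    (X : topologicalType) : tychonoff_space X -> pseudocompact R X ->
  sequentially_ascoli_space R X -> selectively_omega_bounded X.
Proof.
move=> tX pX aX; have [hX _] := tX.
apply/(selectively_omega_boundedP hX) => U oU U0.
apply: contrapT => nL.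
have Lfin L : compact L -> \forall n \near \oo, forall x, L x -> ~ U n x.
  move=> cL; apply: contrapT => Linf; apply: nL; exists L => // N.
  apply: contrapT => LN; apply: Linf; exists N => // n Nn x Lx Ux.
  by apply: LN; exists n => //; exists x.
have /choice[f fP] n := bump_function R tX (oU n) (U0 n).
have cf n : continuous (f n) by have [] := fP n.
pose u n : Ck X R := mkcts (cf n).
have cz : continuous (fun _ : X => 0 : R) by move=> x; exact: cvg_cst.
pose z : Ck X R := mkcts cz.
have uz : u @ \oo --> z.
  apply/Ck_cvgP => L /Lfin LU e e0; apply: filterS LU => n Ln x /Ln nUx.
  have [_ _ /(_ x nUx) fx] := fP n.
  by rewrite -[fn (u n) x]/(f n x) fx subrr normr0.
have eu := aX u z uz.
pose h n x : R := n%:R * Num.max (f n x - 2^-1) 0.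
have h0 n x : 0 <= h n x by rewrite mulr_ge0// le_max lexx orbT.
have ch n : continuous (h n).
  move=> x; apply: cvgM; first exact: cvg_cst.
  apply: (@continuous_max R X (fun x => f n x - 2^-1) (fun=> 0)).
    by apply: cvgB; [exact: cf|exact: cvg_cst].
  exact: cvg_cst.
have hv (x : X) : \forall n \near \oo & y \near x, h n y = 0.
  have [N _ NU] := Lfin _ (@compact_set1 X x).
  have e2 : (0 : R) < 2^-1 by rewrite invr_gt0.
  exists ([set n | (N <= n)%N], [set y | forall g, (range u `|` [set z]) g ->
      ball (fn g x) 2^-1 (fn g y)]).
    split; first by exists N.
    exact: (eu x [set xy | ball xy.1 2^-1 xy.2] (entourage_ball _ (PosNum e2))).
  move=> [n y] /= [Nn /(_ (u n) (or_introl (imageT u n)))].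
  have [_ _ /(_ x (NU n Nn x erefl)) fx0] := fP n.
  rewrite /ball/= -[fn (u n) x]/(f n x) -[fn (u n) y]/(f n y) fx0 sub0r normrN.
  move=> /ltW/(le_trans (ler_norm _)) fy.
  by rewrite /h max_r ?mulr0// subr_le0.
have [M hM] := pseudocompact_bound_locally_vanishing pX ch h0 hv.
have [n] : exists n : nat, `|M| * 2 < n%:R.
  by exists (Num.bound (`|M| * 2)); rewrite archi_boundP// mulr_ge0.
have [_ [x fx1] _] := fP n.
have := hM n x; rewrite /h fx1 max_l; last by rewrite subr_ge0 invf_le1// ler1n.
have := ler_norm M; lra.
Qed.

(** * The equivalence *)

Theorem theorem1p2 (R : realType) (X : topologicalType)
    (tychonoffX : tychonoff_space X) (pseudocompactX : pseudocompact R X) :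
  [<-> selectively_omega_bounded X;
       compact_covering (@sc_adjoint R X);
       ascoli_space R X;
       sequentially_ascoli_space R X].
Proof.
tfae.
- exact: selectively_omega_bounded_compact_covering.
- exact: compact_covering_ascoli.
- by move=> aX u l /compact_sequence_limit; exact: aX.
- exact: sequentially_ascoli_selectively_omega_bounded.
Qed.
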